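(* (Upper bound) There is an absolute constant $C>0$ such that for every $n\ge 1$ and every set $A$ of $n$ points in general position in the plane, the edge set of the complete geometric graph $K_n[A]$ can be covered by at most $n^2/6+Cn$ monotone paths. (Lower bound) On the other hand, for every $n\ge 2$ there exists a set $A$ of $n$ points in general position in the plane such that every covering of the edge set of $K_n[A]$ by monotone paths consists of at least $n^2/15$ paths.
   Context: A set of points in the plane is in general position if no three of its points are collinear. For an $n$-point set $A$ in general position in the plane, the complete geometric graph $K_n[A]$ has vertex set $A$, and its edges are all $\binom n2$ straight-line segments between points of $A$. A polygonal path $\xi=(v_1,v_2,\ldots,v_t)$ in $\mathbb{R}^2$ is monotone in direction $\mathbf{u}\in\mathbb{R}^2\setminus\{\mathbf{0}\}$ if $\langle \overrightarrow{v_iv_{i+1}},\mathbf{u}\rangle>0$ for $i=1,\ldots,t-1$; a path is monotone if it is monotone in some direction $\mathbf{u}\in\mathbb{R}^2\setminus\{\mathbf{0}\}$. The paths are paths in $K_n[A]$, drawn with straight-line edges. A family of paths covers the edge set of $K_n[A]$ if every edge of $K_n[A]$ belongs to at least one path of the family. *)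

(* Defs.v *)
From HB Require Import structures.
From mathcomp Require Import all_boot all_order all_algebra.
From mathcomp Require Import finmap reals.

Set Implicit Arguments.
Unset Strict Implicit.
Unset Printing Implicit Defensive.

Import Order.TTheory GRing.Theory Num.Theory.
Local Open Scope ring_scope.

Section GeometricGraph.
Variable R : realType.
Notation plane := 'rV[R]_2.
Implicit Types (a d p q r u : plane) (A : {fset plane}).
Implicit Types (xi : seq plane) (F : seq (seq plane)).

Definition dotv u d : R := \sum_(i < 2) u 0 i * d 0 i.

Definition on_line a d p : Prop := exists t : R, p = a + t *: d.

Definition collinear p q r : Prop :=
  exists a d, [/\ d != 0, on_line a d p, on_line a d q & on_line a d r].

Definition general_position A : Prop :=
  forall p q r, p \in A -> q \in A -> r \in A ->
    p != q -> p != r -> q != r -> ~ collinear p q r.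

(* The straight-line segment pq is represented by its pair of endpoints;
   the relation is symmetric. *)
Definition geom_edge A : rel plane :=
  fun p q => [&& p \in A, q \in A & p != q].

(* The membership condition matters only for one-vertex paths, where [sorted]
   is vacuous. *)
Definition geom_path A xi : bool :=
  [&& xi != [::], all (mem A) xi, uniq xi & sorted (geom_edge A) xi].

Definition monotone_in u xi : bool :=
  sorted (fun p q => 0 < dotv (q - p) u) xi.

Definition monotone xi : Prop := exists2 u, u != 0 & monotone_in u xi.

(* Edges are undirected, so a path may traverse pq in either direction. *)
Definition edge_of_path p q xi : bool :=
  infix [:: p; q] xi || infix [:: q; p] xi.

Definition covers_edges A F : Prop :=
  forall p q, geom_edge A p q -> exists2 xi, xi \in F & edge_of_path p q xi.

Definition monotone_path_cover A F : Prop :=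
  (forall xi, xi \in F -> geom_path A xi /\ monotone xi) /\ covers_edges A F.

End GeometricGraph.

(* Main.v *)
Require Import Defs.
From mathcomp Require Import all_boot all_order all_algebra.
From mathcomp Require Import finmap reals.
From mathcomp Require Import zify ring lra.

Set Implicit Arguments.
Unset Strict Implicit.
Unset Printing Implicit Defensive.

Import Order.TTheory GRing.Theory Num.Theory.
Local Open Scope ring_scope.

(** Both bounds rest on one picture.  Read every edge from left to right; its
    slope then decides how a monotone path may use it: a path monotone in a
    direction orthogonal to slope [s] runs along edges steeper than [s] one way
    and along edges flatter than [s] the other way.

    Upper bound.  Let ab, with a left of b, be the steepest edge of some edge
    set, ac another edge of the set leaving a to the right and db another edge
    entering b from the left.  Then c, a, b, d is a monotone path: choose a
    slope slightly below that of ab, so that ab is traversed forwards and the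
    two flatter edges backwards ([monotone_zigzag]).  So three edges at a time
    can be removed from the edge set.  When ac or db is missing, ab is covered
    by a path of its own; but then a has lost its last edge to the right, or b
    its last edge to the left, and this happens at most 2n times.  The number
    of paths is thus at most a third of the number of edges plus a linear term
    ([zigzag_cover]).  Points on a common vertical are handled by ordering the
    plane lexicographically.

    Lower bound.  Take the points (2^i, 4^i) for i < n.  The edge between i < j
    has slope 2^i + 2^j, which lies strictly between 2^j and 2^(j+1), so the
    larger endpoint alone determines the slope up to a factor of two.  Hence
    every direction u has, up to sign, a turning index t: the scalar product
    with u is decreasing on the indices below t, and each index above t beats
    all smaller ones ([para_turning_index]).  A monotone path therefore goes
    down below t, with at most one detour through t, and then goes up above t.
    Cut the indices into three tiers of almost equal size and count the edges
    that join different tiers: there are about n^2/3 of them, and a path uses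
    at most 5: going down from the tier k of t costs at most k, the detour
    through t costs 2, the jump over t costs 1 and going up costs at most 2 - k
    ([walk_weight_le5]).  This gives n^2/15 up to rounding, since for n not
    divisible by 3 there are only (n^2 - 1)/3 such edges.  The rounding is
    absorbed by letting one edge, from the lowest point to the lowest point of
    the top tier, count twice: the bound 5 survives. *)

(** * Weights of walks *)

Section Walks.
Local Open Scope nat_scope.
Implicit Types (w : nat -> nat -> nat) (s : seq nat).

Definition walk_weight w s := \sum_(e <- zip s (behead s)) w e.1 e.2.

Lemma walk_weight1 w x : walk_weight w [:: x] = 0.
Proof. by rewrite /walk_weight big_nil. Qed.

Lemma walk_weight_cons w x y s :
  walk_weight w [:: x, y & s] = w x y + walk_weight w (y :: s).
Proof. by rewrite /walk_weight big_cons. Qed.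

Lemma walk_weight_rcons w x y s :
  walk_weight w (rcons (rcons s x) y) = walk_weight w (rcons s x) + w x y.
Proof.
elim: s => [|z [|z' s] IHs].
  by rewrite walk_weight_cons !walk_weight1 addn0.
  by rewrite /= !walk_weight_cons !walk_weight1 !addn0.
by move: IHs; rewrite !rcons_cons !walk_weight_cons => ->; rewrite addnA.
Qed.

Lemma walk_weight_rev w s :
  (forall x y, w x y = w y x) -> walk_weight w (rev s) = walk_weight w s.
Proof.
move=> w_sym; elim: s => [|x [|y s] IHs] //.
rewrite walk_weight_cons !rev_cons walk_weight_rcons -rev_cons IHs.
by rewrite addnC w_sym.
Qed.

Lemma infix2E (T : eqType) (i j : T) (s : seq T) :
  infix [:: i; j] s = ((i, j) \in zip s (behead s)).
Proof.
elim: s => [|x [|y s] IHs] //; first by rewrite infixs1 /=; apply/eqP; case.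
rewrite infix_consl IHs inE xpair_eqE /= prefix0s.
by case: (i == x); case: (j == y).
Qed.

Lemma sum_eq n x (g : nat -> nat) :
  \sum_(i < n) (i == x :> nat) * g i = (x < n) * g x.
Proof.
have [lt_xn|le_nx] := ltnP x n; last first.
  by rewrite big1 // => i _; rewrite ltn_eqF // (leq_trans (ltn_ord i)).
rewrite (bigD1 (Ordinal lt_xn)) //= eqxx big1 ?addn0 // => i ne_ix.
by rewrite (negPf (_ : i != x :> nat)).
Qed.

Lemma sum_mem_le w n (E : seq (nat * nat)) :
  \sum_(i < n) \sum_(j < n) ((i : nat, j : nat) \in E) * w i j
    <= \sum_(e <- E) w e.1 e.2.
Proof.
elim: E => [|[x y] E IHE]; first by rewrite big1 // => i _; rewrite big1.
rewrite big_cons; apply: leq_trans (leq_add (leqnn _) IHE).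
pose row i := \sum_(j < n) (j == y :> nat) * w i j.
apply: (@leq_trans (\sum_(i < n) ((i == x :> nat) * row i +
    \sum_(j < n) ((i : nat, j : nat) \in E) * w i j))).
  apply: leq_sum => i _; rewrite big_distrr -big_split; apply: leq_sum => j _.
  rewrite /= inE xpair_eqE mulnA -mulnDl leq_mul //.
  by case: (_ == x); case: (_ == y); case: (_ \in E).
rewrite big_split leq_add2r (sum_eq n x row) /row (sum_eq n y (w x)) mulnA.
by case: ltnP => _; case: ltnP => _; rewrite // mul1n.
Qed.

(** Double counting.  Both sums run over ordered pairs, so each step of a walk
    is counted in its two orientations; hence the factor 2. *)
Lemma weight_cover_le w n b (Fs : seq (seq nat)) :
    (forall x y, w x y = w y x) -> (forall x, w x x = 0) ->
    (forall i j, i < n -> j < n -> i != j ->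
       exists2 s, s \in Fs & infix [:: i; j] s || infix [:: j; i] s) ->
    (forall s, s \in Fs -> walk_weight w s <= b) ->
  \sum_(i < n) \sum_(j < n) w i j <= 2 * b * size Fs.
Proof.
move=> w_sym w_diag cov w_le.
have le_step s : \sum_(i < n) \sum_(j < n) infix [:: val i; val j] s * w i j
    <= walk_weight w s.
  apply: leq_trans (sum_mem_le _ n _); apply: leq_sum => i _.
  by apply: leq_sum => j _; rewrite infix2E.
pose hit (i j : nat) s := (infix [:: i; j] s + infix [:: j; i] s) * w i j.
apply: (@leq_trans (\sum_(s <- Fs) \sum_(i < n) \sum_(j < n) hit i j s)).
  rewrite [leqRHS]exchange_big; apply: leq_sum => i _.
  rewrite [leqRHS]exchange_big; apply: leq_sum => j _ /=.
  have [-> | ne_ij] := eqVneq i j; first by rewrite w_diag.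
  have [s s_Fs sij] := cov i j (ltn_ord i) (ltn_ord j) ne_ij.
  rewrite (big_rem s) //=; apply: leq_trans (leq_addr _ _).
  by rewrite leq_pmull // addn_gt0 !lt0b.
apply: (@leq_trans (\sum_(s <- Fs) 2 * b)); last first.
  by rewrite big_const_seq iter_addn_0 count_predT.
rewrite !big_seq; apply: leq_sum => s s_Fs.
under eq_bigr do under eq_bigr do rewrite /hit mulnDl.
under eq_bigr do rewrite big_split /=.
rewrite big_split /= mul2n -addnn leq_add ?(leq_trans (le_step s)) ?w_le //.
rewrite exchange_big; apply: leq_trans (w_le s s_Fs).
apply: leq_trans (le_step s); apply: leq_sum => i _; apply: leq_sum => j _.
by rewrite w_sym.
Qed.

End Walks.

(** * Tiers and unimodal walks *)

Section Tiers.
Local Open Scope nat_scope.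
Variables m1 m2 : nat.
Hypothesis le_m12 : m1 <= m2.

Definition tier i := (m1 <= i) + (m2 <= i).

(** The one pair that may count twice joins the least index to the least index of
    the top tier.  It makes up for the rounding when the tiers have unequal
    sizes. *)
Definition heavy i j := (minn i j == 0) && (maxn i j == m2).

(** Bounding the weight by the difference of the tiers makes it telescope along
    monotone runs of indices, the doubled pair included; the second bound
    matters only where a walk changes its course. *)
Definition tier_weight i j :=
  minn ((tier i - tier j) + (tier j - tier i)) (1 + heavy i j).

Lemma tier_weightC i j : tier_weight i j = tier_weight j i.
Proof. by rewrite /tier_weight /heavy addnC (minnC i j) (maxnC i j). Qed.

Lemma tier_weightxx i : tier_weight i i = 0.
Proof. by rewrite /tier_weight subnn min0n. Qed.

Lemma tier_mono i j : i <= j -> tier i <= tier j.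
Proof. by rewrite /tier; lia. Qed.

Lemma tier_le2 i : tier i <= 2.
Proof. by rewrite /tier; lia. Qed.

Lemma tier_weight_rise i j : i <= j -> tier_weight i j + tier i <= tier j.
Proof. by move=> /tier_mono; rewrite /tier_weight; lia. Qed.

Lemma tier_weight_fall i j : j <= i -> tier_weight i j + tier j <= tier i.
Proof. by rewrite tier_weightC; apply: tier_weight_rise. Qed.

Lemma tier_weight_heavy i j : tier_weight i j <= 1 + heavy i j.
Proof. exact: geq_minr. Qed.

(** The shape of the heights [f] of the points in a fixed direction: falling
    below the turning index [t], with a record at each later index.  [f t]
    itself may take any place among the earlier values. *)
Variables (R : realType) (f : nat -> R) (n t : nat).
Hypothesis f_below : forall i j, i < j -> j < t -> (f j < f i)%R.
Hypothesis f_above : forall i j, i < j -> t < j -> j < n -> (f i < f j)%R.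

Let up : rel nat := fun i j => (f i < f j)%R.

Lemma step_below i j : i < t -> j < t -> up i j -> j < i.
Proof.
move=> lt_it lt_jt f_ij; case: (ltngtP i j) => // [lt_ij | eq_ij].
  by have := lt_trans f_ij (f_below lt_ij lt_jt); rewrite ltxx.
by move: f_ij; rewrite /up eq_ij ltxx.
Qed.

Lemma step_above i j : t < i -> i < n -> up i j -> i < j.
Proof.
move=> lt_ti lt_in f_ij; case: (ltngtP i j) => // [lt_ji | eq_ij].
  by have := lt_trans f_ij (f_above lt_ji lt_ti lt_in); rewrite ltxx.
by move: f_ij; rewrite /up eq_ij ltxx.
Qed.

(** Above the turning index the walk climbs, and its weight telescopes. *)
Lemma walk_above x s : all (gtn n) (x :: s) -> path up x s -> t < x ->
  walk_weight tier_weight (x :: s) + tier x <= 2.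
Proof.
elim: s x => [|y s IHs] x; first by rewrite walk_weight1 tier_le2.
rewrite walk_weight_cons => /andP[lt_xn s_n] /andP[f_xy y_s] lt_tx.
have lt_xy := step_above lt_tx lt_xn f_xy.
have := IHs y s_n y_s (ltn_trans lt_tx lt_xy).
by have := tier_weight_rise (ltnW lt_xy); lia.
Qed.

(** The jump over [t] costs 1 and the climb that follows at most
    [2 - tier t].  A jump of cost 2 starts below the top tier and lands on
    [m2], from where the climb is free; and [t < m2] is then below the top tier
    too. *)
Lemma walk_leave x y s : all (gtn n) (y :: s) -> path up y s ->
  x < t -> t < y -> walk_weight tier_weight [:: x, y & s] + tier t <= 3.
Proof.
move=> s_n y_s lt_xt lt_ty; have := walk_above s_n y_s lt_ty.
have := tier_weight_heavy x y.
by rewrite walk_weight_cons /heavy /tier; lia.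
Qed.

(** Once higher than [t], a walk that is still below the index [t] cannot visit
    [t] any more: it descends at telescoping cost and ends with one jump. *)
Lemma walk_past x s : all (gtn n) (x :: s) -> path up x s ->
  x < t -> up t x -> walk_weight tier_weight (x :: s) + tier t <= tier x + 3.
Proof.
elim: s x => [|y s IHs] x.
  by move=> *; rewrite walk_weight1; have := tier_le2 t; lia.
move=> /andP[lt_xn s_n] /andP[f_xy y_s] lt_xt f_tx.
have f_ty : up t y := lt_trans f_tx f_xy.
case: (ltngtP y t) => [lt_yt | lt_ty | eq_yt]; last first.
- by move: f_ty; rewrite /up eq_yt ltxx.
- by have := walk_leave s_n y_s lt_xt lt_ty; lia.
have lt_yx := step_below lt_xt lt_yt f_xy.
have := IHs y s_n y_s lt_yt f_ty; have := tier_weight_fall (ltnW lt_yx).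
by rewrite walk_weight_cons; lia.
Qed.

Lemma walk_at s : all (gtn n) (t :: s) -> path up t s ->
  walk_weight tier_weight (t :: s) <= 3.
Proof.
case: s => [|y s]; first by rewrite walk_weight1.
move=> /andP[lt_tn s_n] /andP[f_ty y_s]; rewrite walk_weight_cons.
case: (ltngtP y t) => [lt_yt | lt_ty | eq_yt]; last first.
- by move: f_ty; rewrite /up eq_yt ltxx.
- have := walk_above s_n y_s lt_ty.
  by have := tier_weight_rise (ltnW lt_ty); lia.
have := walk_past s_n y_s lt_yt f_ty.
by have := tier_weight_fall (ltnW lt_yt); lia.
Qed.

(** The detour through [t] interrupts the descent from [x] to the next index
    [y < x], at a cost of 1 for each of its two steps.  The step from [x] is
    never the heavy one, as [x] is not the least index; the step to [y] can be,
    but only for [t = m2]. *)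
Lemma walk_detour x s : all (gtn n) (t :: s) -> path up t s ->
  x < t -> up x t ->
  walk_weight tier_weight [:: x, t & s] + tier t <= tier x + 5 + (t == m2).
Proof.
move=> t_s_n t_s lt_xt f_xt.
have wxt := tier_weight_rise (ltnW lt_xt); have t_le2 := tier_le2 t.
case: s t_s_n t_s => [|y s] /andP[lt_tn s_n].
  by rewrite walk_weight_cons walk_weight1; lia.
move=> /andP[f_ty y_s]; rewrite !walk_weight_cons.
case: (ltngtP y t) => [lt_yt | lt_ty | eq_yt]; last first.
- by move: f_ty; rewrite /up eq_yt ltxx.
- have := walk_above s_n y_s lt_ty.
  by have := tier_weight_rise (ltnW lt_ty); lia.
have lt_yx := step_below lt_xt lt_yt (lt_trans f_xt f_ty).
have := walk_past s_n y_s lt_yt f_ty; have := tier_mono (ltnW lt_yx).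
have xt_plain : heavy x t = false by rewrite /heavy; lia.
have ty_heavy : heavy t y <= (t == m2) by rewrite /heavy; lia.
have := tier_weight_heavy x t; have := tier_weight_heavy t y.
by rewrite xt_plain; lia.
Qed.

Lemma walk_below x s : all (gtn n) (x :: s) -> path up x s -> x < t ->
  walk_weight tier_weight (x :: s) + tier t <= tier x + 5 + (t == m2).
Proof.
elim: s x => [|y s IHs] x.
  by move=> *; rewrite walk_weight1; have := tier_le2 t; lia.
move=> /andP[lt_xn s_n] /andP[f_xy y_s] lt_xt.
case: (ltngtP y t) => [lt_yt | lt_ty | eq_yt].
- have lt_yx := step_below lt_xt lt_yt f_xy.
  have := IHs y s_n y_s lt_yt; have := tier_weight_fall (ltnW lt_yx).
  by rewrite walk_weight_cons; lia.
- by have := walk_leave s_n y_s lt_xt lt_ty; lia.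
by move: s_n f_xy y_s; rewrite eq_yt => *; apply: walk_detour.
Qed.

(** A start below [t] has [tier x <= tier t], and for [t = m2] even
    [tier x < tier t]: this pays for the heavy pair. *)
Lemma walk_weight_le5 s : all (gtn n) s -> sorted up s ->
  walk_weight tier_weight s <= 5.
Proof.
case: s => [|x s] s_n x_s; first by rewrite /walk_weight big_nil.
case: (ltngtP x t) => [lt_xt | lt_tx | eq_xt].
- by have := walk_below s_n x_s lt_xt; rewrite /tier; lia.
- by have := walk_above s_n x_s lt_tx; lia.
by move: s_n x_s; rewrite eq_xt => s_n x_s; have := walk_at s_n x_s; lia.
Qed.

End Tiers.

(** * The total weight *)

Section TierSum.
Local Open Scope nat_scope.

Lemma sum_tier (m1 m2 n : nat) (g : nat -> nat) : m1 <= m2 -> m2 <= n ->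
  \sum_(i < n) g (tier m1 m2 i) = m1 * g 0 + (m2 - m1) * g 1 + (n - m2) * g 2.
Proof.
move=> le_m12 le_m2n.
have sum_const a b k :
    (forall i, a <= i < b -> tier m1 m2 i = k) ->
    \sum_(a <= i < b) g (tier m1 m2 i) = (b - a) * g k.
  move=> tier_k; rewrite -sum_nat_const_nat.
  by apply: eq_big_nat => i /tier_k ->.
rewrite -(big_mkord xpredT (fun i => g (tier m1 m2 i))).
rewrite (@big_cat_nat _ _ _ m1) ?(leq_trans le_m12) //=.
rewrite [X in _ + X](@big_cat_nat _ _ _ m2) //= addnA.
rewrite (sum_const 0 m1 0) ?(sum_const m1 m2 1) ?(sum_const m2 n 2) ?subn0 //;
  by move=> i; rewrite /tier; lia.
Qed.

Lemma tier_weight_ge m1 m2 i j : 0 < m1 -> m1 <= m2 ->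
  (tier m1 m2 i != tier m1 m2 j) + ((i == 0) * (j == m2) + (j == 0) * (i == m2))
    <= tier_weight m1 m2 i j.
Proof.
move=> m1_gt0 le_m12.
have [t0 tm2] : tier m1 m2 0 = 0 /\ tier m1 m2 m2 = 2 by rewrite /tier; lia.
rewrite /tier_weight /heavy.
case: (eqVneq i 0) => [-> | i_gt0]; case: (eqVneq j 0) => [-> | j_gt0];
  rewrite ?t0 ?mul0n ?mul1n ?addn0 ?add0n.
- lia.
- by case: (eqVneq j m2) => [-> | _]; rewrite ?tm2; lia.
- by case: (eqVneq i m2) => [-> | _]; rewrite ?tm2; lia.
- lia.
Qed.

(** For tiers of sizes a, b, c the sum over ordered pairs is at least
    2(ab + ac + bc) + 2, where the last 2 comes from the heavy pair; for
    balanced tiers 3(ab + ac + bc) >= n^2 - 1. *)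
Lemma sum_tier_weight n : 2 < n ->
  2 * n ^ 2 <=
    3 * \sum_(i < n) \sum_(j < n) tier_weight (n %/ 3) (2 * n %/ 3) i j.
Proof.
move=> lt_2n.
have [m1_gt0 le_m12 lt_m2n] : [/\ 0 < n %/ 3, n %/ 3 <= 2 * n %/ 3
  & 2 * n %/ 3 < n] by split; lia.
have balanced : n ^ 2 <= 3 * (n %/ 3 * (2 * n %/ 3 - n %/ 3)
    + n %/ 3 * (n - 2 * n %/ 3)
    + (2 * n %/ 3 - n %/ 3) * (n - 2 * n %/ 3)) + 3.
  have [q [r [lt_r3 ->]]] : exists q r, r < 3 /\ n = 3 * q + r.
    by exists (n %/ 3), (n %% 3); lia.
  have -> : (3 * q + r) %/ 3 = q by lia.
  have -> : 2 * (3 * q + r) %/ 3 = 2 * q + (r == 2) by lia.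
  by case: r lt_r3 => [|[|[|]]] //= _; rewrite -mulnn; nia.
move: (n %/ 3) (2 * n %/ 3) m1_gt0 le_m12 lt_m2n balanced.
move=> m1 m2 m1_gt0 le_m12 lt_m2n balanced; have le_m2n := ltnW lt_m2n.
pose apart i j := (tier m1 m2 i != tier m1 m2 j) : nat.
pose bonus (i j : nat) := (i == 0) * (j == m2) + (j == 0) * (i == m2).
have sum_bonus : \sum_(i < n) \sum_(j < n) bonus i j = 2.
  have sum1 x : x < n -> \sum_(j < n) (j == x :> nat) = 1.
    move=> lt_xn; transitivity (\sum_(j < n) (j == x :> nat) * 1).
      by apply: eq_bigr => j _; rewrite muln1.
    by rewrite (sum_eq n x (fun=> 1)) lt_xn.
  have n_gt0 : 0 < n by lia.
  under eq_bigr do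
    rewrite big_split -big_distrr -big_distrl /= !sum1 // muln1 mul1n.
  by rewrite big_split /= !sum1.
have sum_apart : \sum_(i < n) \sum_(j < n) apart i j =
    2 * (m1 * (m2 - m1) + m1 * (n - m2) + (m2 - m1) * (n - m2)).
  pose row k := m1 * (k != 0) + (m2 - m1) * (k != 1) + (n - m2) * (k != 2).
  rewrite (eq_bigr (fun i : 'I_n => row (tier m1 m2 i))) => [|i _].
    by rewrite sum_tier // /row /=; lia.
  by rewrite (sum_tier (fun k => tier m1 m2 i != k)).
apply: (@leq_trans (3 * \sum_(i < n) \sum_(j < n) (apart i j + bonus i j))).
  under eq_bigr do rewrite big_split /=.
  by rewrite big_split /= sum_apart sum_bonus; lia.
rewrite leq_pmul2l //; apply: leq_sum => i _; apply: leq_sum => j _.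
exact: tier_weight_ge.
Qed.

End TierSum.

(** * Plane geometry *)

Section Plane.
Variable R : realType.
Implicit Types (p q r u v : 'rV[R]_2).

Lemma dotvE u v : dotv u v = u 0 0 * v 0 0 + u 0 1 * v 0 1.
Proof.
rewrite /dotv !big_ord_recl big_ord0 addr0.
by congr (_ + u 0 _ * v 0 _); apply: val_inj.
Qed.

Lemma row2P u v : u 0 0 = v 0 0 -> u 0 1 = v 0 1 -> u = v.
Proof.
move=> eq0 eq1; apply/rowP => -[[|[|//]] lt_i2].
  by rewrite (_ : Ordinal _ = 0) //; apply: val_inj.
by rewrite (_ : Ordinal _ = 1) //; apply: val_inj.
Qed.

Definition det2 u v : R := u 0 0 * v 0 1 - u 0 1 * v 0 0.

Lemma collinear_det2 p q r : collinear p q r -> det2 (q - p) (r - p) = 0.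
Proof.
move=> [a [d [_ [x ->] [y ->] [z ->]]]].
by rewrite /det2 !mxE; ring.
Qed.

Lemma det2_collinear p q r : q != p -> det2 (q - p) (r - p) = 0 ->
  collinear p q r.
Proof.
move=> ne_qp det0; exists p, (q - p); split.
- by rewrite subr_eq0.
- by exists 0; rewrite scale0r addr0.
- by exists 1; rewrite scale1r addrC subrK.
move: det0; rewrite /det2 !mxE => det0.
have [dx0 | dx_neq0] := eqVneq (q 0 0 - p 0 0) 0; last first.
  exists ((r 0 0 - p 0 0) / (q 0 0 - p 0 0)).
  apply: row2P; rewrite !mxE.
    by field.
  apply: (mulfI dx_neq0).
  transitivity ((q 0 0 - p 0 0) * p 0 1 + (q 0 1 - p 0 1) * (r 0 0 - p 0 0));
    last by field.
  by move: det0 => /eqP; rewrite subr_eq0 => /eqP <-; ring.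
have dy_neq0 : q 0 1 - p 0 1 != 0.
  apply: contraNneq ne_qp => dy0; apply/eqP/row2P; lra.
(* The line pq is vertical here, so r is reached by comparing ordinates. *)
exists ((r 0 1 - p 0 1) / (q 0 1 - p 0 1)); apply: row2P; rewrite !mxE.
  rewrite dx0 mulr0 addr0.
  move: det0; rewrite dx0 mul0r sub0r => /eqP; rewrite oppr_eq0 mulf_eq0.
  by rewrite (negPf dy_neq0) subr_eq0 => /eqP.
by field.
Qed.

End Plane.

(** * Geometric progressions on a parabola *)

Section Parabola.
Variable R : realType.
Implicit Types (u p q : 'rV[R]_2) (n i j k : nat).

Definition para i : 'rV[R]_2 := \row_(k < 2) ((2 ^+ i) ^+ k.+1).

Lemma det2_para i j k :
  det2 (para j - para i) (para k - para i) =
    (2 ^+ j - 2 ^+ i) * (2 ^+ k - 2 ^+ i) * (2 ^+ k - 2 ^+ j).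
Proof. by rewrite /det2 !mxE /=; ring. Qed.

Lemma dotv_paraB u i j :
  dotv (para j) u - dotv (para i) u =
    (2 ^+ j - 2 ^+ i) * (u 0 0 + u 0 1 * (2 ^+ i + 2 ^+ j)).
Proof. by rewrite !dotvE !mxE /=; ring. Qed.

Lemma para_inj : injective para.
Proof.
move=> i j /rowP/(_ 0); rewrite !mxE /= !expr1; apply: ieexprIn => //.
by rewrite (eqr_nat R 2 1).
Qed.

Lemma ltr_pow2 i j : ((2 : R) ^+ i < 2 ^+ j) = (i < j)%N.
Proof. by rewrite ltr_eXn2l ?(ltr_nat R 1 2). Qed.

Lemma collinear_para i j k :
  collinear (para i) (para j) (para k) -> [|| i == j, i == k | j == k].
Proof.
move=> /collinear_det2; rewrite det2_para => /eqP; rewrite !mulf_eq0 !subr_eq0.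
rewrite !(inj_eq (ieexprIn _ _)) ?(eqr_nat R 2 1) //.
by rewrite eq_sym (eq_sym k) (eq_sym k) orbA.
Qed.

Lemma dotvBl p q u : dotv (q - p) u = dotv q u - dotv p u.
Proof. by rewrite !dotvE !mxE; ring. Qed.

Lemma dotvN p u : dotv p (- u) = - dotv p u.
Proof. by rewrite !dotvE !mxE; ring. Qed.

(** The height rises from i to j > i exactly when
    [u 0 0 + u 0 1 * (2 ^+ i + 2 ^+ j)] is positive, and that sum of powers lies
    between [2 ^+ j] and [2 ^+ j.+1].  So the sign is negative for all i once it
    is nonpositive at [2 ^+ j.+1], and positive for all i once it is positive
    at [2 ^+ j].  Only the j between these two cases is undecided: it is the
    least one at which [2 ^+ j.+1] gives a positive value, or n if there is
    none below n. *)
Lemma para_turning_index u n : u != 0 -> 0 <= u 0 1 ->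
  exists t,
    (forall i j, (i < j)%N -> (j < t)%N ->
       dotv (para j) u < dotv (para i) u) /\
    (forall i j, (i < j)%N -> (t < j)%N -> (j < n)%N ->
       dotv (para i) u < dotv (para j) u).
Proof.
move=> u_neq0 u1_ge0.
pose rises t := 0 < u 0 0 + u 0 1 * 2 ^+ t.+1.
have rises_ex : exists t, rises t || (t == n) by exists n; rewrite eqxx orbT.
case: (ex_minnP rises_ex) => t rise_t t_min; exists t; split=> i j lt_ij.
  move=> lt_jt; have : ~~ rises j.
    by apply: contraL lt_jt => rise_j; rewrite -leqNgt t_min ?rise_j.
  rewrite -subr_lt0 dotv_paraB -leNgt exprS => stop_j.
  have lt2 : (2 : R) ^+ i < 2 ^+ j by rewrite ltr_pow2.
  rewrite pmulr_rlt0 ?subr_gt0 //.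
  have [u1_0 | u1_neq0] := eqVneq (u 0 1) 0; last first.
    have u1_gt0 : 0 < u 0 1 by rewrite lt_def u1_neq0.
    by nra.
  (* A horizontal direction that never rises points to the left. *)
  move: stop_j; rewrite u1_0 !mul0r !addr0 => u0_le0.
  rewrite lt_def u0_le0 andbT eq_sym; apply: contra u_neq0 => /eqP u0_0.
  by apply/eqP/row2P; rewrite mxE.
move=> lt_tj lt_jn; rewrite -subr_gt0 dotv_paraB.
have rise : rises t by case/orP: rise_t => // /eqP eq_tn; lia.
have lt2 : (2 : R) ^+ i < 2 ^+ j by rewrite ltr_pow2.
rewrite pmulr_rgt0 ?subr_gt0 //.
have le2 : (2 : R) ^+ t.+1 <= 2 ^+ j by rewrite ler_eXn2l ?(ltr_nat R 1 2).
have pos2 : 0 < (2 : R) ^+ i by rewrite exprn_gt0.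
move: rise; rewrite /rises; nra.
Qed.

(** Reversing a path and negating its direction changes neither monotonicity
    nor weight, so the direction may be assumed not to point downwards. *)
Lemma para_path_weight n m1 m2 s : (m1 <= m2)%N -> all (gtn n) s ->
  monotone (map para s) -> (walk_weight (tier_weight m1 m2) s <= 5)%N.
Proof.
move=> le_m12 s_n [u u_neq0]; rewrite /monotone_in sorted_map.
pose up v i j := dotv (para i) v < dotv (para j) v.
rewrite (@eq_sorted _ _ (up u)) => [mono_s | i j /=]; last first.
  by rewrite dotvBl subr_gt0.
wlog u1_ge0 : u s u_neq0 s_n mono_s / 0 <= u 0 1.
  move=> claim; have [/claim-> // | /ltW u1_le0] := leP 0 (u 0 1).
  rewrite -walk_weight_rev; last exact: tier_weightC.
  apply: (claim (- u)); rewrite ?oppr_eq0 ?all_rev ?mxE ?oppr_ge0 //.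
  rewrite rev_sorted (@eq_sorted _ _ (up u)) // => i j.
  by rewrite /up !dotvN ltrN2.
have [t [below above]] := para_turning_index n u_neq0 u1_ge0.
exact: (walk_weight_le5 le_m12 below above).
Qed.

End Parabola.

(** * The lower bound *)

Section LowerBound.
Variable R : realType.

Definition para_set n : {fset 'rV[R]_2} :=
  [fset p in [seq para R i | i <- iota 0 n]]%fset.

Lemma mem_para_set n p :
  reflect (exists2 i, (i < n)%N & p = para R i) (p \in para_set n).
Proof.
rewrite !inE; apply: (iffP mapP) => -[i i_n ->]; exists i => //.
  by move: i_n; rewrite mem_iota.
by rewrite mem_iota.
Qed.

Lemma card_para_set n : #|` para_set n|%fset = n.
Proof.
rewrite card_fseq undup_id ?size_map ?size_iota //.
by rewrite map_inj_uniq ?iota_uniq //; apply: para_inj.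
Qed.

Lemma general_position_para_set n : general_position (para_set n).
Proof.
move=> _ _ _ /mem_para_set[i _ ->] /mem_para_set[j _ ->] /mem_para_set[k _ ->].
rewrite !(inj_eq (@para_inj R)) => ne_ij ne_ik ne_jk /collinear_para.
by rewrite (negPf ne_ij) (negPf ne_ik) (negPf ne_jk).
Qed.

Lemma para_cover_ge n F : (2 <= n)%N -> monotone_path_cover (para_set n) F ->
  (n ^ 2 <= 15 * size F)%N.
Proof.
move=> le_2n [paths_F cov_F].
have para_mem i : (i < n)%N -> para R i \in para_set n.
  by move=> lt_in; apply/mem_para_set; exists i.
have edge_para i j : (i < n)%N -> (j < n)%N -> i != j ->
    geom_edge (para_set n) (para R i) (para R j).
  move=> lt_in lt_jn ne_ij.
  by rewrite /geom_edge !para_mem // (inj_eq (@para_inj R)).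
(* For n = 2 the lowest tier is empty, and any path at all suffices. *)
have [lt_2n | le_n2] := ltnP 2 n; last first.
  have [xi xi_F _] := cov_F _ _ (edge_para 0 1 (ltnW le_2n) le_2n isT).
  have F_gt0 : (0 < size F)%N by case: (F) xi_F.
  by rewrite (_ : n = 2); lia.
pose ind p := index p [seq para R i | i <- iota 0 n].
have indK i : (i < n)%N -> ind (para R i) = i.
  move=> lt_in; rewrite /ind index_map; last exact: para_inj.
  rewrite -[X in index X _](@nth_iota 0 0 n i) //.
  by rewrite index_uniq ?iota_uniq ?size_iota.
have w_le5 s : s \in [seq map ind xi | xi <- F] ->
    (walk_weight (tier_weight (n %/ 3) (2 * n %/ 3)) s <= 5)%N.
  move=> /mapP[xi xi_F ->]; have [/and4P[_ xi_A _ _] mono_xi] := paths_F _ xi_F.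
  apply: (@para_path_weight R n); first by lia.
    rewrite all_map; apply: sub_all xi_A => p /mem_para_set[i lt_in ->].
    by rewrite /= indK.
  rewrite -map_comp map_id_in // => p p_xi /=.
  by have /mem_para_set[i lt_in ->] := allP xi_A p p_xi; rewrite indK.
have cov_ind i j : (i < n)%N -> (j < n)%N -> i != j ->
    exists2 s, s \in [seq map ind xi | xi <- F] &
      infix [:: i; j] s || infix [:: j; i] s.
  move=> lt_in lt_jn ne_ij.
  have [xi xi_F e_xi] := cov_F _ _ (edge_para i j lt_in lt_jn ne_ij).
  exists (map ind xi); first exact: map_f.
  have infix_ind a b : (a < n)%N -> (b < n)%N ->
      infix [:: para R a; para R b] xi -> infix [:: a; b] (map ind xi).
    move=> lt_an lt_bn /infixP[s1 [s2 ->]]; rewrite !map_cat /= !indK //.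
    exact: (infix_infix _ [:: a; b]).
  by case/orP: e_xi => /infix_ind ->; rewrite ?orbT.
have := weight_cover_le (tier_weightC _ _) (tier_weightxx _ _) cov_ind w_le5.
rewrite size_map; have := sum_tier_weight lt_2n.
by move: (\sum_(i < n) _) (n ^ 2)%N (size F) => total sq k; lia.
Qed.

Lemma parabola_lower_bound n : (2 <= n)%N ->
  exists A : {fset 'rV[R]_2},
    [/\ #|` A|%fset = n, general_position A &
        forall F : seq (seq 'rV[R]_2), monotone_path_cover A F ->
          n%:R ^+ 2 / 15%:R <= (size F)%:R :> R].
Proof.
move=> le_2n; exists (para_set n); split; first exact: card_para_set.
  exact: general_position_para_set.
move=> F cov_F; rewrite ler_pdivrMr ?(ltr_nat R 0 15) //.
by rewrite -natrX -natrM ler_nat mulnC para_cover_ge.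
Qed.

End LowerBound.

(** * Extracting zigzags from a set of edges *)

Section Zigzag.
Variables (R : realType) (T : eqType) (key : T * T -> R).
Implicit Types (E : seq (T * T)) (xi : seq T).

(** An edge (a, b) is directed; in a path c, a, b, d the middle edge is run
    forwards and the two outer edges, neither of which has a larger key,
    backwards. *)
Variant zigzag E xi : Prop :=
| ZigzagEdge a b of (a, b) \in E & xi = [:: a; b]
| ZigzagPath a b c d of (a, b) \in E & (a, c) \in E & (d, b) \in E
    & c != b & d != a & key (a, c) <= key (a, b) & key (d, b) <= key (a, b)
    & xi = [:: c; a; b; d].

Lemma zigzag_sub E E' xi : {subset E' <= E} -> zigzag E' xi -> zigzag E xi.
Proof.
move=> sub [a b /sub ab -> | a b c d /sub ab /sub ac /sub db cb da kc kd ->].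
  exact: (ZigzagEdge ab).
exact: (ZigzagPath ab ac db).
Qed.

Lemma exists_max_key E : E != [::] ->
  exists2 e, e \in E & {in E, forall e', key e' <= key e}.
Proof.
elim: E => [//|e [|e1 E] IHE] _.
  by exists e; rewrite ?mem_head // => e'; rewrite inE => /eqP->.
have [m m_E m_max] := IHE isT.
have [le_em|lt_me] := leP (key e) (key m).
  exists m; first by rewrite inE m_E orbT.
  by move=> e'; rewrite inE => /predU1P[-> // | /m_max].
exists e; first exact: mem_head.
move=> e'; rewrite inE => /predU1P[-> // | /m_max le_m].
exact: le_trans le_m (ltW lt_me).
Qed.

Lemma leq_size_undup (S : eqType) (s s' : seq S) : {subset s <= s'} ->
  (size (undup s) <= size (undup s'))%N.
Proof.
move=> sub; apply: uniq_leq_size (undup_uniq s) _ => x.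
by rewrite !mem_undup => /sub.
Qed.

Lemma ltn_size_undup (S : eqType) (s s' : seq S) x : {subset s <= s'} ->
  x \in s' -> x \notin s -> (size (undup s) < size (undup s'))%N.
Proof.
move=> sub x_s' x_s; apply: (@uniq_leq_size _ (x :: undup s)).
  by rewrite /= mem_undup x_s undup_uniq.
by move=> y; rewrite inE !mem_undup => /predU1P[-> // | /sub].
Qed.

Definition sources E := undup [seq e.1 | e <- E].
Definition targets E := undup [seq e.2 | e <- E].

Definition edge_in (e : T * T) xi :=
  infix [:: e.1; e.2] xi || infix [:: e.2; e.1] xi.

(** Remove an edge (a, b) of maximal key, together with another edge out of a
    and another edge into b.  If one of the two is missing, then a ceases to be
    a source or b ceases to be a target; a drop of 1 in that count, with weight
    2, and of 1 in the number of edges pays for the path spent on (a, b)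
    alone. *)
Lemma zigzag_cover E : uniq E ->
  exists F, [/\ forall xi, xi \in F -> zigzag E xi,
    {in E, forall e, exists2 xi, xi \in F & edge_in e xi} &
    (3 * size F <= size E + 2 * (size (sources E) + size (targets E)))%N].
Proof.
have [m] := ubnP (size E); elim: m E => // m IHm E.
rewrite ltnS => le_Em E_uniq.
have [-> | E_neq0] := eqVneq E [::]; first by exists [::]; split.
have [[a b] ab_E key_max] := exists_max_key E_neq0.
pose E1 := rem (a, b) E.
have sub1 : {subset E1 <= E} by exact: mem_rem.
have uniq1 : uniq E1 by exact: rem_uniq.
have E1E e : (e \in E1) = (e != (a, b)) && (e \in E) by rewrite mem_rem_uniq.
have size1 : size E = (size E1).+1.
  by rewrite size_rem // prednK //; case: (E) ab_E.
have sub_sizes (E' : seq (T * T)) : {subset E' <= E} ->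
    (size (sources E') <= size (sources E))%N /\
    (size (targets E') <= size (targets E))%N.
  by move=> sub; split; apply: leq_size_undup => x /mapP[e /sub e_E ->];
    apply: map_f.
have single : (size (sources E1) + size (targets E1) <
    size (sources E) + size (targets E))%N ->
    exists F, [/\ forall xi, xi \in F -> zigzag E xi,
      {in E, forall e, exists2 xi, xi \in F & edge_in e xi} &
      (3 * size F <= size E + 2 * (size (sources E) + size (targets E)))%N].
  move=> lt_st; have [|F [zig_F cov_F size_F]] := IHm E1 _ uniq1.
    by rewrite -size1.
  exists ([:: a; b] :: F); split=> [xi | e e_E |].
  - rewrite inE => /predU1P[-> | /zig_F]; first exact: (ZigzagEdge ab_E).
    exact: zigzag_sub.
  - have [-> | ne_e] := eqVneq e (a, b).
      by exists [:: a; b]; rewrite ?mem_head // /edge_in infix_refl.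
    have [|xi xi_F e_xi] := cov_F e; first by rewrite E1E ne_e.
    by exists xi; rewrite // inE xi_F orbT.
  rewrite size1 /= mulnS (leq_trans (leq_add (leqnn 3) size_F)) //.
  by move: lt_st; clear; lia.
have [le_s1 le_t1] := sub_sizes E1 sub1.
have [/hasP[[a' c] ac1 /eqP/= eq_a] | /hasPn no_ac] :=
  boolP (has (fun e => e.1 == a) E1); last first.
  apply: single; rewrite -addSn leq_add //.
  apply: (ltn_size_undup (x := a)).
  - by move=> x /mapP[e /sub1 e_E ->]; apply: map_f.
  - by apply/mapP; exists (a, b).
  by apply/mapP=> -[e /no_ac /eqP ne_a eq_a]; rewrite eq_a in ne_a.
have [/hasP[[d b'] db1 /eqP/= eq_b] | /hasPn no_db] :=
  boolP (has (fun e => e.2 == b) E1); last first.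
  apply: single; rewrite -addnS leq_add //.
  apply: (ltn_size_undup (x := b)).
  - by move=> x /mapP[e /sub1 e_E ->]; apply: map_f.
  - by apply/mapP; exists (a, b).
  by apply/mapP=> -[e /no_db /eqP ne_b eq_b]; rewrite eq_b in ne_b.
subst a' b'.
have /andP[ne_cb ac_E] : (c != b) && ((a, c) \in E).
  by move: ac1; rewrite E1E xpair_eqE eqxx.
have /andP[ne_da db_E] : (d != a) && ((d, b) \in E).
  by move: db1; rewrite E1E xpair_eqE eqxx andbT.
pose E2 := rem (a, c) E1; pose E3 := rem (d, b) E2.
have E2E e : (e \in E2) = (e != (a, c)) && (e \in E1) by rewrite mem_rem_uniq.
have uniq2 : uniq E2 by exact: rem_uniq.
have E3E e : (e \in E3) = (e != (d, b)) && (e \in E2) by rewrite mem_rem_uniq.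
have db2 : (d, b) \in E2 by rewrite E2E db1 xpair_eqE (negPf ne_da).
have size3 : size E = (size E3).+3.
  rewrite size1 -[size E1](@prednK _) -?(size_rem ac1) ?(size_rem db2) //;
    last by case: (E1) ac1.
  by rewrite prednK //; case: (E2) db2.
have sub3 : {subset E3 <= E}.
  by move=> e; rewrite E3E E2E E1E => /and4P[].
have [le_s3 le_t3] := sub_sizes E3 sub3.
have [||F [zig_F cov_F size_F]] := IHm E3; [| exact: rem_uniq |].
  by apply: leq_trans le_Em; rewrite size3 !ltnS leqW.
exists ([:: c; a; b; d] :: F); split=> [xi | e e_E |].
- rewrite inE => /predU1P[-> | /zig_F]; last exact: zigzag_sub.
  by apply: (ZigzagPath ab_E ac_E db_E) => //; apply: key_max.
- have [/cov_F[xi xi_F e_xi] | ] := boolP (e \in E3).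
    by exists xi; rewrite // inE xi_F orbT.
  move=> e_new; exists [:: c; a; b; d]; first exact: mem_head.
  move: e_new; rewrite E3E E2E E1E e_E andbT /edge_in.
  by case/nandP=> [/negPn|/nandP[]/negPn] /eqP ->; rewrite /= !eqxx ?orbT.
rewrite size3 /= mulnS (leq_trans (leq_add (leqnn 3) size_F)) //.
by move: le_s3 le_t3; clear; lia.
Qed.

End Zigzag.

(** * The upper bound *)

Section UpperBound.
Variable R : realType.
Notation plane := 'rV[R]_2.
Implicit Types (a b c d p q u v : plane) (A : {fset plane}).

Lemma dotvv_gt0 v : v != 0 -> 0 < dotv v v.
Proof.
move=> v_neq0; rewrite dotvE -!expr2 lt_def addr_ge0 ?sqr_ge0 // andbT.
apply: contra v_neq0; rewrite paddr_eq0 ?sqr_ge0 // !sqrf_eq0.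
by move=> /andP[/eqP v0 /eqP v1]; apply/eqP/row2P; rewrite mxE.
Qed.

Lemma monotone_edge p q : p != q -> monotone [:: p; q].
Proof.
move=> ne_pq; exists (q - p); first by rewrite subr_eq0 eq_sym.
by rewrite /monotone_in /= andbT dotvv_gt0 // subr_eq0 eq_sym.
Qed.

(** The hypotheses put c and d on opposite sides of the line ab, so the path
    turns one way at a and the other way at b.  The direction that works is
    almost normal to ab: rotate ab by a right angle, scale it up so that it
    dominates on the outer edges, and add ab itself to get the sign right on
    the middle edge, where the rotated vector vanishes. *)
Lemma monotone_zigzag a b c d :
  0 < det2 (c - a) (b - a) -> 0 < det2 (b - d) (b - a) ->
  monotone [:: c; a; b; d].
Proof.
set D1 := det2 _ _; set D2 := det2 _ _ => D1_gt0 D2_gt0.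
set e := b - a.
have e_neq0 : e != 0.
  by apply: contraTneq D1_gt0; rewrite /D1 /det2 -/e => ->; rewrite !mxE; lra.
pose N := `|dotv (c - a) e| + `|dotv (b - d) e| + 1.
pose M := N / D1 + N / D2.
have N_ge0 : 0 <= N by rewrite !addr_ge0.
have M1 : N <= M * D1.
  by rewrite mulrDl divfK ?gt_eqF // lerDl !mulr_ge0 ?invr_ge0 // ltW.
have M2 : N <= M * D2.
  by rewrite mulrDl divfK ?gt_eqF // lerDr !mulr_ge0 ?invr_ge0 // ltW.
pose u : plane := e + M *: \row_(k < 2) (if k == 0 then - e 0 1 else e 0 0).
have dot_u v : dotv v u = dotv v e - M * det2 v e.
  by rewrite !dotvE /det2 !mxE /=; ring.
have det_ee : det2 e e = 0 by rewrite /det2; ring.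
have dot_e : 0 < dotv e u by rewrite dot_u det_ee mulr0 subr0 dotvv_gt0.
exists u.
  by apply: contraTneq dot_e => ->; rewrite dotvE !mxE; lra.
rewrite /monotone_in /= dot_e /= andbT.
have neg p q : dotv (q - p) u = - dotv (p - q) u.
  by rewrite !dotvE !mxE; ring.
rewrite !(neg _ a) !(neg _ d) !dot_u -/D1 -/D2.
have := ler_norm (dotv (c - a) e); have := ler_norm (dotv (b - d) e).
have := normr_ge0 (dotv (c - a) e); have := normr_ge0 (dotv (b - d) e).
by rewrite /N in M1 M2 => *; apply/andP; split; lra.
Qed.

(** Left-to-right order, with ties on a vertical broken upwards, so that each
    edge has exactly one positive orientation. *)
Definition lex_pos v := (0 < v 0 0) || (v 0 0 == 0) && (0 < v 0 1).

Lemma lex_pos_total v : v != 0 -> lex_pos v || lex_pos (- v).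
Proof.
move=> v_neq0; rewrite /lex_pos !mxE !oppr_gt0 oppr_eq0.
case: (ltrgtP (v 0 0) 0) => //= v0; case: (ltrgtP (v 0 1) 0) => //= v1.
by case/eqP: v_neq0; apply: row2P; rewrite mxE.
Qed.

Lemma lex_pos_asym v : lex_pos v -> ~~ lex_pos (- v).
Proof.
rewrite /lex_pos !mxE !oppr_gt0 oppr_eq0.
by case: (ltrgtP (v 0 0) 0) => //= _; case: (ltrgtP (v 0 1) 0).
Qed.

Lemma lex_pos_neq0 v : lex_pos v -> v != 0.
Proof. by apply: contraTneq => ->; rewrite /lex_pos !mxE ltxx andbF. Qed.

(** An increasing function of the slope that stays finite on vertical vectors:
    the 1-norm of a lexicographically positive vector is its denominator. *)
Definition inclination v := v 0 1 / (v 0 0 + `|v 0 1|).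

Lemma inclination_det2 u v : lex_pos u -> lex_pos v ->
  inclination u <= inclination v -> 0 <= det2 u v.
Proof.
have den_gt0 w : lex_pos w -> 0 < w 0 0 + `|w 0 1|.
  case/orP=> [w0 | /andP[/eqP-> w1]]; first by rewrite ltr_wpDr.
  by rewrite add0r normr_gt0 gt_eqF.
have x_ge0 w : lex_pos w -> 0 <= w 0 0.
  by case/orP=> [/ltW | /andP[/eqP->]].
move=> u_pos v_pos; rewrite /inclination ler_pdivrMr ?den_gt0 // mulrAC.
rewrite ler_pdivlMr ?den_gt0 // /det2.
have := x_ge0 u u_pos; have := x_ge0 v v_pos.
case: (lerP 0 (u 0 1)) => u1; case: (lerP 0 (v 0 1)) => v1;
  rewrite ?(ger0_norm u1) ?(ger0_norm v1) ?(ltr0_norm u1) ?(ltr0_norm v1);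
  nra.
Qed.

Definition lex_edges A :=
  [seq e <- [seq (p, q) | p <- A, q <- A] | lex_pos (e.2 - e.1)].

Lemma mem_lex_edges A p q :
  ((p, q) \in lex_edges A) = [&& p \in A, q \in A & lex_pos (q - p)].
Proof.
rewrite mem_filter andbC /=; case: (lex_pos _); rewrite ?andbF // !andbT.
by apply/allpairsP/andP=> [[[x y] /= [xA yA [-> ->]]] | [pA qA]] //;
  exists (p, q).
Qed.

Lemma lex_edges_uniq A : uniq (lex_edges A).
Proof.
by rewrite filter_uniq // allpairs_uniq ?fset_uniq // => -[? ?] [? ?].
Qed.

(** Together with their reversals, these edges inject into A x A. *)
Lemma size_lex_edges A : (2 * size (lex_edges A) <= #|` A|%fset ^ 2)%N.
Proof.
pose swap (e : plane * plane) := (e.2, e.1).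
have swap_inj : injective swap by move=> [? ?] [? ?] [-> ->].
rewrite mul2n -addnn -{2}(size_map swap) -size_cat.
apply: (@leq_trans (size [seq (p, q) | p <- A, q <- A])); last first.
  by rewrite size_allpairs -mulnn.
apply: uniq_leq_size.
  rewrite cat_uniq (map_inj_uniq swap_inj) !lex_edges_uniq andbT /=.
  apply/hasPn => _ /mapP[[p q] pq ->]; apply/negP.
  move: pq; rewrite !mem_lex_edges => /and3P[_ _ /lex_pos_asym].
  by rewrite opprB => /negPf->; rewrite !andbF.
move=> e; rewrite mem_cat mem_filter => /orP[/andP[] // | /mapP[[p q]]].
rewrite mem_lex_edges => /and3P[pA qA _] ->.
by apply/allpairsP; exists (q, p).
Qed.

(** Keys only give weak inequalities between slopes; edges that share a vertex
    have distinct slopes by general position, so the determinants needed for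
    monotonicity are positive.  For c = d these determinants would have
    opposite signs. *)
Lemma zigzag_geom_path A xi : general_position A ->
  zigzag (fun e => inclination (e.2 - e.1)) (lex_edges A) xi ->
  geom_path A xi /\ monotone xi.
Proof.
move=> gpA [a b | a b c d]; rewrite !mem_lex_edges.
  move=> /and3P[aA bA /lex_pos_neq0 ab] ->; rewrite subr_eq0 eq_sym in ab.
  split; last exact: monotone_edge.
  by rewrite /geom_path /geom_edge /= aA bA !inE ab.
move=> /and3P[aA bA ab_pos] /and3P[_ cA ac_pos] /and3P[dA _ db_pos] ne_cb ne_da.
rewrite /= => ac_le db_le ->.
have [ne_ba ne_ca ne_bd] : [/\ b != a, c != a & b != d].
  by split; rewrite -subr_eq0 lex_pos_neq0.
have det_c : 0 < det2 (c - a) (b - a).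
  rewrite lt_def inclination_det2 // andbT; apply/eqP => det0.
  by case: (gpA a c b) => //;
    [rewrite eq_sym | rewrite eq_sym | exact: det2_collinear].
have det_d : 0 < det2 (b - d) (b - a).
  rewrite lt_def inclination_det2 // andbT; apply/eqP => det0.
  case: (gpA b d a) => //; apply: det2_collinear; first by rewrite eq_sym.
  by rewrite -det0 /det2 !mxE; ring.
have ne_cd : c != d.
  apply: contraTneq det_c => eq_cd; rewrite -leNgt.
  by move: (ltW det_d); rewrite -eq_cd /det2 !mxE; lra.
split; last exact: monotone_zigzag.
rewrite /geom_path /geom_edge /= !inE aA bA cA dA.
by rewrite !negb_or ne_ca ne_cb ne_cd ne_bd (eq_sym a) ne_ba (eq_sym a) ne_da.
Qed.

Lemma zigzag_upper_bound n A :
  #|` A|%fset = n -> general_position A ->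
  exists F : seq (seq plane), monotone_path_cover A F /\
    (size F)%:R <= n%:R ^+ 2 / 6%:R + 2 * n%:R :> R.
Proof.
move=> cardA gpA.
have [F [zig_F cov_F size_F]] :=
  zigzag_cover (fun e => inclination (e.2 - e.1)) (lex_edges_uniq A).
exists F; split; first split.
- by move=> xi /zig_F; apply: zigzag_geom_path.
- move=> p q /and3P[pA qA ne_pq].
  have : lex_pos (q - p) || lex_pos (p - q).
    by rewrite -[p - q]opprB lex_pos_total // subr_eq0 eq_sym.
  case/orP=> pos.
    by have [|xi] := cov_F (p, q); [rewrite mem_lex_edges pA qA | exists xi].
  have [|xi xi_F e_xi] := cov_F (q, p); first by rewrite mem_lex_edges pA qA.
  by exists xi; rewrite // /edge_of_path orbC.
have size_s : (size (sources (lex_edges A)) <= n)%N.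
  rewrite -cardA; apply: uniq_leq_size (undup_uniq _) _ => p.
  rewrite mem_undup => /mapP[[x y]].
  by rewrite mem_lex_edges => /and3P[xA _ _] ->.
have size_t : (size (targets (lex_edges A)) <= n)%N.
  rewrite -cardA; apply: uniq_leq_size (undup_uniq _) _ => p.
  rewrite mem_undup => /mapP[[x y]].
  by rewrite mem_lex_edges => /and3P[_ yA _] ->.
have := size_lex_edges A; rewrite cardA => size_E.
have : (6 * size F <= n ^ 2 + 8 * n)%N.
  rewrite -[6%N]/(2 * 3)%N -mulnA.
  apply: leq_trans (leq_mul (leqnn 2) size_F) _.
  rewrite mulnDr leq_add // -[8%N]/(2 * 2 * 2)%N -!mulnA !leq_mul //.
  by rewrite mul2n -addnn leq_add.
rewrite -(ler_nat R) natrD natrX !natrM => le_6.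
have n_ge0 : 0 <= n%:R :> R by [].
have := le_6; move: (n%:R ^+ 2) => x.
lra.
Qed.

End UpperBound.

Theorem theorem6 (R : realType) :
  (exists C : R, 0 < C /\
     forall (n : nat) (A : {fset 'rV[R]_2}),
       (1 <= n)%N -> #|` A|%fset = n -> general_position A ->
       exists F : seq (seq 'rV[R]_2),
         monotone_path_cover A F /\
         (size F)%:R <= n%:R ^+ 2 / 6%:R + C * n%:R)
  /\
  (forall n : nat, (2 <= n)%N ->
     exists A : {fset 'rV[R]_2},
       [/\ #|` A|%fset = n, general_position A &
           forall F : seq (seq 'rV[R]_2),
             monotone_path_cover A F ->
             n%:R ^+ 2 / 15%:R <= (size F)%:R :> R]).
Proof.
split; last exact: parabola_lower_bound.
exists 2; split; first by rewrite ltr0n.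
by move=> n A _; apply: zigzag_upper_bound.
Qed.
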